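(* Let $(X,\|\cdot\|)$ be a uniformly convex and uniformly smooth reflexive real Banach space of dimension $\geq 3$, with dual $X^*$ and duality pairing $\langle\cdot,\cdot\rangle$. Then the following assertions are equivalent: (i) The metric projection onto every nonempty closed linear subspace of $X$ is linear; (ii) The metric projection onto the intersection of any pair of closed hyperplanes of $X$ is linear; (iii) $J^{-1}:X^*\to X$ maps two-dimensional linear subspaces of $X^*$ onto two-dimensional linear subspaces of $X$, i.e. for every two-dimensional linear subspace $\mathcal D\subseteq X^*$, the set $J^{-1}(\mathcal D)$ is a two-dimensional linear subspace of $X$; (iv) The polar of the intersection of any pair of closed halfspaces of $X$ is convex; (v) Each nonempty closed convex cone in $X$ has a convex polar; (vi) $X$ is an inner product space (its norm is generated by an inner product).
   Context: For a nonempty closed convex set $C\subseteq X$, the metric projection $P_C:X\to C$ is $P_Cx=\operatorname{argmin}\{\|x-c\|: c\in C\}$ (well defined and single valued in this setting). A closed hyperplane is a set $\{x\in X:\langle a,x\rangle=0\}$ with $a\in X^*$, $\|a\|^*=1$; the associated closed halfspaces are $\{x:\langle a,x\rangle\ge 0\}$ and $\{x:\langle a,x\rangle\le 0\}$ (these pass through the origin, so intersections of two of them are closed convex cones). A set $K\subseteq X$ is a cone if $\lambda x\in K$ for all $x\in K$, $\lambda\ge 0$, and a convex cone if moreover $x+y\in K$ for $x,y\in K$. For a nonempty closed convex cone $K$, its polar is $K^\circ=\{x\in X: P_Kx=0\}$. The normalized duality map $J:X\to X^*$ is defined by $\langle Jx,x\rangle=\|Jx\|^*\|x\|=\|x\|^2=(\|Jx\|^*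 )^2$; in this setting it is a single-valued homeomorphism with inverse $J^{-1}:X^*\to X$. *)

(* Defs.v *)
From mathcomp Require Import all_boot all_order all_algebra.
From mathcomp Require Import all_classical all_reals all_analysis.
Set Implicit Arguments. Unset Strict Implicit. Unset Printing Implicit Defensive.
Import Order.TTheory GRing.Theory Num.Theory.
Import numFieldNormedType.Exports.
Local Open Scope classical_set_scope.
Local Open Scope ring_scope.

Section Defs.
Variables (R : realType) (X : completeNormedModType R).

Definition dual_elt (f : X -> R) : Prop :=
  (forall (a b : R) (x y : X), f (a *: x + b *: y) = a * f x + b * f y) /\
  continuous f.

Definition dnorm (f : X -> R) : R :=
  sup [set `|f x| | x in [set x : X | `|x| <= 1]].

Definition reflexive_space : Prop :=
  forall Phi : (X -> R) -> R,
    (forall (a b : R) (f g : X -> R), dual_elt f -> dual_elt g ->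
        Phi (fun z => a * f z + b * g z) = a * Phi f + b * Phi g) ->
    (exists C : R, forall f, dual_elt f -> `|Phi f| <= C * dnorm f) ->
    exists x : X, forall f, dual_elt f -> Phi f = f x.

Definition uniformly_convex : Prop :=
  forall eps : R, 0 < eps <= 2 -> exists2 delta : R, 0 < delta &
    forall x y : X, `|x| <= 1 -> `|y| <= 1 -> eps <= `|x - y| ->
      `|(2^-1) *: (x + y)| <= 1 - delta.

Definition smooth_modulus (tau : R) : R :=
  sup [set r : R | exists x y : X, [/\ `|x| = 1, `|y| = 1 &
        r = (`|x + tau *: y| + `|x - tau *: y|) / 2 - 1]].

Definition uniformly_smooth : Prop :=
  forall eps : R, 0 < eps -> exists2 delta : R, 0 < delta &
    forall tau : R, 0 < tau < delta -> smooth_modulus tau / tau <= eps.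

Definition lin_indep3 (x y z : X) : Prop :=
  forall a b c : R, a *: x + b *: y + c *: z = 0 -> [/\ a = 0, b = 0 & c = 0].

Definition dim_ge3 : Prop := exists x y z : X, lin_indep3 x y z.

Definition metric_proj (C : set X) (x : X) : X :=
  xget 0 [set c | C c /\ forall c', C c' -> `|x - c| <= `|x - c'|].

Definition linear_map (P : X -> X) : Prop :=
  forall (a b : R) (x y : X), P (a *: x + b *: y) = a *: P x + b *: P y.

Definition closed_subspace (M : set X) : Prop :=
  [/\ closed M, M 0 & forall (a b : R) x y, M x -> M y -> M (a *: x + b *: y)].

Definition closed_hyperplane (H : set X) : Prop :=
  exists2 a : X -> R, dual_elt a /\ dnorm a = 1 & H = [set x | a x = 0].

Definition closed_halfspace (S : set X) : Prop :=
  exists2 a : X -> R, dual_elt a /\ dnorm a = 1 &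
    S = [set x | 0 <= a x] \/ S = [set x | a x <= 0].

Definition nonempty_closed_convex_cone (K : set X) : Prop :=
  [/\ K !=set0, closed K,
      forall (l : R) x, 0 <= l -> K x -> K (l *: x) &
      forall x y, K x -> K y -> K (x + y)].

Definition polar (K : set X) : set X := [set x | metric_proj K x = 0].

Definition duality_map (x : X) : X -> R :=
  xget (fun _ => 0) [set f | dual_elt f /\
     f x = dnorm f * `|x| /\ dnorm f * `|x| = `|x| ^+ 2 /\ `|x| ^+ 2 = dnorm f ^+ 2].

Definition Jinv_image (D : set (X -> R)) : set X := [set x | D (duality_map x)].

Definition two_dim_subspace (S : set X) : Prop :=
  exists x y : X,
    (forall a b : R, a *: x + b *: y = 0 -> a = 0 /\ b = 0) /\
    S = [set z | exists a b : R, z = a *: x + b *: y].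

Definition two_dim_dual_subspace (D : set (X -> R)) : Prop :=
  exists f g : X -> R, [/\ dual_elt f, dual_elt g,
    (forall a b : R, (fun z => a * f z + b * g z) = (fun _ => 0) -> a = 0 /\ b = 0) &
    D = [set h | exists a b : R, h = (fun z => a * f z + b * g z)]].

Definition inner_product_space : Prop :=
  exists B : X -> X -> R,
    [/\ forall (a b : R) x y z, B (a *: x + b *: y) z = a * B x z + b * B y z,
        forall x y, B x y = B y x &
        forall x, `|x| = Num.sqrt (B x x)].

End Defs.

(* Main.v *)
Require Import Defs.
From mathcomp Require Import all_boot all_order all_algebra.
From mathcomp Require Import all_classical all_reals all_analysis.
From mathcomp Require Import ring lra.
Import Order.TTheory GRing.Theory Num.Theory.
Import numFieldNormedType.Exports.
Local Open Scope classical_set_scope.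
Local Open Scope ring_scope.

(** Write [J] for the duality map; [J x w = 0] means that [x] is Birkhoff
    orthogonal to [w], and [J x] vanishes (resp. is nonpositive) on a closed
    subspace (resp. cone) exactly when [x] projects to [0] on it.  Testing (ii),
    (iii) and (iv) on the hyperplanes, planes and halfspaces given by [J x] and
    [J y] shows that each implies left additivity of this orthogonality:
    [J x w = 0] and [J y w = 0] give [J (x + y) w = 0].

    In dimension at least 3 this makes [J] symmetric.  Given [x] orthogonal to
    [y], choose [z] orthogonal to both [x] and [y], and let [u] in span(x, y) be
    killed by [J y].  Comparing [x + l y], [z + m y] and their sum (as in the
    fundamental theorem of projective geometry) shows that
    [sigma l = J (x + l y) y / J (x + l y) u] is additive; it is also positive
    for [l > 0], so [sigma l = k l].  This is a differential equation for
    [|x + l y|^2], whose solution multiplies the quadratic polynomial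
    [1 + c l + k l^2] by a factor monotone in [l]; following the factor through
    the point at infinity of the projective line forces it to be constant, so
    [c = 0] and the norm is Euclidean on span(x, y).

    Conversely, in an inner product space [J] is linear, and all assertions
    follow from the description of projections and polars by [J]. *)

(** * One-sided derivative of the norm *)

Section NormDerivative.
Variables (R : realType) (X : completeNormedModType R).
Implicit Types (x y z w : X) (a b c t l : R).

Definition slope x y t : R := (`|x + t *: y| - `|x|) / t.

(** Right derivative of the norm at [x] along [y]: by convexity the slopes are nondecreasing in [t],
    so the infimum is their limit at [0], with no convergence to prove. *)
Definition norm_deriv x y : R := inf [set slope x y t | t in [set t | 0 < t]].

Lemma slope_ge x y t : 0 < t -> - `|y| <= slope x y t.
Proof.
move=> t0; rewrite /slope ler_pdivlMr// mulNr.
have := ler_normB (x + t *: y) (t *: y); rewrite addrK normrZ gtr0_norm //; nra.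
Qed.

Lemma slope_le_norm x y t : 0 < t -> slope x y t <= `|y|.
Proof.
move=> t0; rewrite /slope ler_pdivrMr//.
have := ler_normD x (t *: y); rewrite normrZ gtr0_norm //; nra.
Qed.

Lemma norm_deriv_le x y t : 0 < t -> norm_deriv x y <= slope x y t.
Proof.
move=> t0; apply: ge_inf; last by exists t.
by exists (- `|y|) => _ [s s0 <-]; exact: slope_ge.
Qed.

Lemma le_norm_deriv x y l :
  (forall t, 0 < t -> l <= slope x y t) -> l <= norm_deriv x y.
Proof.
move=> H; apply: lb_le_inf; first by exists (slope x y 1), 1 => //=; exact: ltr01.
by move=> _ [s s0 <-]; exact: H.
Qed.

(* Adding a slope at [t] and a slope at [s] dominates the slope at half their
   harmonic mean, by convexity of the norm; so no monotonicity is needed. *)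
Lemma slope_subadd x y z t s : 0 < t -> 0 < s ->
  slope x (y + z) (t * s / (t + s)) <= slope x y t + slope x z s.
Proof.
move=> t0 s0; have ts0 : 0 < t + s by rewrite addr_gt0.
rewrite /slope; set r := t * s / (t + s).
have r0 : 0 < r by rewrite divr_gt0// mulr_gt0.
have e : x + r *: (y + z) =
    (s / (t + s)) *: (x + t *: y) + (t / (t + s)) *: (x + s *: z).
  rewrite !scalerDr !scalerA addrACA -scalerDl -mulrDl (addrC s) divff ?gt_eqF//.
  by rewrite scale1r; congr (_ + (_ *: _ + _ *: _)); rewrite /r; field; rewrite gt_eqF.
have : `|x + r *: (y + z)| <=
   (s / (t + s)) * `|x + t *: y| + (t / (t + s)) * `|x + s *: z|.
  have s1 : 0 <= s / (t + s) by rewrite ltW// divr_gt0.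
  have t1 : 0 <= t / (t + s) by rewrite ltW// divr_gt0.
  by rewrite e (le_trans (ler_normD _ _))// (normrZ (_ / _)) (normrZ (t / _)) !ger0_norm.
rewrite ler_pdivrMr//.
have -> : ((`|x + t *: y| - `|x|) / t + (`|x + s *: z| - `|x|) / s) * r =
 (s / (t + s)) * `|x + t *: y| + (t / (t + s)) * `|x + s *: z| - `|x|.
  by rewrite /r; field; rewrite !gt_eqF.
by move=> h; rewrite lerB.
Qed.

Lemma norm_deriv_subadd x y z :
  norm_deriv x (y + z) <= norm_deriv x y + norm_deriv x z.
Proof.
rewrite -lerBlDr; apply: le_norm_deriv => t t0.
rewrite lerBlDr [leRHS]addrC -lerBlDr; apply: le_norm_deriv => s s0.
rewrite lerBlDr [leRHS]addrC; apply: le_trans (slope_subadd _ _ _ t s t0 s0).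
by apply: norm_deriv_le; rewrite divr_gt0 ?mulr_gt0 ?addr_gt0.
Qed.

Lemma norm_deriv_pZ_le x y c : 0 < c -> norm_deriv x (c *: y) <= c * norm_deriv x y.
Proof.
move=> c0; rewrite mulrC -ler_pdivrMr//; apply: le_norm_deriv => t t0.
rewrite ler_pdivrMr//.
have tc : 0 < t / c by rewrite divr_gt0.
apply: le_trans (norm_deriv_le _ _ _ tc) _; rewrite /slope scalerA divfK ?gt_eqF//.
by rewrite le_eqVlt; apply/orP; left; apply/eqP; field; rewrite !gt_eqF.
Qed.

Lemma norm_deriv_pZ x y c : 0 < c -> norm_deriv x (c *: y) = c * norm_deriv x y.
Proof.
move=> c0; apply/eqP; rewrite eq_le norm_deriv_pZ_le//=.
have ci : 0 < c^-1 by rewrite invr_gt0.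
have := norm_deriv_pZ_le x (c *: y) _ ci.
by rewrite scalerA mulVf ?gt_eqF// scale1r mulrC ler_pdivlMr// mulrC.
Qed.

Lemma norm_deriv0 x : norm_deriv x 0 = 0.
Proof.
apply/eqP; rewrite eq_le; apply/andP; split.
  by apply: le_trans (norm_deriv_le _ _ _ ltr01) _; rewrite /slope scaler0 addr0 subrr mul0r.
by apply: le_norm_deriv => t _; rewrite /slope scaler0 addr0 subrr mul0r.
Qed.

Lemma norm_derivxx x : norm_deriv x x = `|x|.
Proof.
have H t : 0 < t -> slope x x t = `|x|.
  move=> t0; rewrite /slope -{1}(scale1r x) -scalerDl normrZ ger0_norm.
    by field; rewrite gt_eqF.
  by rewrite addr_ge0// ltW.
apply/eqP; rewrite eq_le; apply/andP; split; first by rewrite -[leRHS](H 1) ?norm_deriv_le.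
by apply: le_norm_deriv => t /H ->.
Qed.

Hypothesis smooth : uniformly_smooth X.

Lemma smooth_modulus_ge x y t : `|x| = 1 -> `|y| = 1 -> 0 < t ->
  (`|x + t *: y| + `|x - t *: y|) / 2 - 1 <= smooth_modulus X t.
Proof.
move=> x1 y1 t0; apply: ub_le_sup; last by exists x, y.
exists t => _ [u [v [u1 v1 ->]]].
have := ler_normD u (t *: v); have := ler_normB u (t *: v).
by rewrite !normrZ u1 v1 gtr0_norm//; lra.
Qed.

(** The sum of the two slopes is a second difference of the norm divided by [t]. Normalizing [x] and
    [y] bounds it by a multiple of [smooth_modulus X s / s] with [s = t |y| / |x|]. *)
Lemma smooth_slope x y (e : R) : x != 0 -> 0 < e -> exists2 d, 0 < d &
  forall t, 0 < t < d -> slope x y t + slope x (- y) t <= e.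
Proof.
move=> x0 e0; have [->|y0] := eqVneq y 0.
  exists 1 => // t _; rewrite /slope oppr0 scaler0 addr0 subrr mul0r addr0.
  exact: ltW.
have a0 : 0 < `|x| by rewrite normr_gt0.
have b0 : 0 < `|y| by rewrite normr_gt0.
have [d d0 Hd] := smooth (e / (2 * `|y|)) (divr_gt0 e0 (mulr_gt0 (ltr0Sn R 1) b0)).
exists (d * `|x| / `|y|); first by rewrite !mulr_gt0 ?invr_gt0.
move=> t /andP[t0 td]; set s := t * `|y| / `|x|.
have s0 : 0 < s by rewrite !mulr_gt0 ?invr_gt0.
have sd : s < d by rewrite /s ltr_pdivrMr// -ltr_pdivlMr.
have sub1 u : u != 0 :> X -> `| `|u|^-1 *: u| = 1.
  by move=> u0; rewrite normrZ normfV normr_id mulVf// normr_eq0.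
have := Hd s; rewrite s0 sd => /(_ isT); rewrite ler_pdivrMr// => Hs.
have := le_trans (smooth_modulus_ge _ _ _ (sub1 _ x0) (sub1 _ y0) s0) Hs.
have E v : `|x| *: (`|x|^-1 *: x + s *: (`|y|^-1 *: v)) = x + t *: v.
  rewrite scalerDr !scalerA divff ?gt_eqF// scale1r.
  by congr (_ + _ *: _); rewrite /s; field; rewrite !gt_eqF.
have E1 v : `|x + t *: v| = `|x| * `| `|x|^-1 *: x + s *: (`|y|^-1 *: v)|.
  by rewrite -E normrZ normr_id.
rewrite /slope !E1 scalerN scalerN.
set A := `|_ + _|; set B := `|_ - _| => h.
rewrite -mulrDl ler_pdivrMr//.
have -> : e * t = 2 * `|x| * (e / (2 * `|y|) * s) by rewrite /s; field; rewrite !gt_eqF.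
have : 2 * `|x| * ((A + B) / 2 - 1) <= 2 * `|x| * (e / (2 * `|y|) * s).
  by rewrite ler_pM2l// mulr_gt0.
by apply: le_trans; rewrite le_eqVlt; apply/orP; left; apply/eqP; field.
Qed.

(** Subadditivity at [y] and [- y] gives one inequality; smoothness makes the sum of the two slopes
    arbitrarily small and gives the other. *)
Lemma norm_derivN x y : x != 0 -> norm_deriv x (- y) = - norm_deriv x y.
Proof.
move=> x0; apply/eqP; rewrite eq_le; apply/andP; split; last first.
  by have := norm_deriv_subadd x y (- y); rewrite subrr norm_deriv0; lra.
apply/ler_addgt0Pr => e e0; have [d d0 H] := smooth_slope x y e x0 e0.
have h : 0 < d / 2 < d by lra.
have h0 : 0 < d / 2 by lra.
have := H _ h; have := norm_deriv_le x y _ h0; have := norm_deriv_le x (- y) _ h0; lra.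
Qed.

Lemma norm_derivD x y z : x != 0 ->
  norm_deriv x (y + z) = norm_deriv x y + norm_deriv x z.
Proof.
move=> x0; apply/eqP; rewrite eq_le norm_deriv_subadd/=.
have := norm_deriv_subadd x (- y) (- z).
by rewrite -opprD !norm_derivN//; lra.
Qed.

Lemma norm_derivZ x y c : x != 0 -> norm_deriv x (c *: y) = c * norm_deriv x y.
Proof.
move=> x0; case: (ltgtP c 0) => [c0|c0|->].
- by rewrite -[c]opprK scaleNr norm_derivN// norm_deriv_pZ ?oppr_gt0// !mulNr.
- exact: norm_deriv_pZ.
- by rewrite scale0r norm_deriv0 mul0r.
Qed.

Lemma norm_deriv_ler x y : x != 0 -> `|norm_deriv x y| <= `|y|.
Proof.
move=> x0; have H z : norm_deriv x z <= `|z|.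
  by apply: le_trans (norm_deriv_le _ _ _ ltr01) (slope_le_norm _ _ _ ltr01).
by rewrite ler_norml H andbT lerNl -norm_derivN// -[leRHS]normrN H.
Qed.

(** The assumptions give [t f(y) <= |x + t y| - |x|], so [f] lies below the derivative; at [- y]
    this is the reverse inequality. *)
Lemma norm_deriv_uniq x (f : X -> R) : x != 0 ->
  (forall y z, f (y + z) = f y + f z) -> (forall c y, f (c *: y) = c * f y) ->
  (forall y, `|f y| <= `|y|) -> f x = `|x| -> f = norm_deriv x.
Proof.
move=> x0 fD fZ fb fx.
have H y : f y <= norm_deriv x y.
  apply: le_norm_deriv => t t0; rewrite /slope ler_pdivlMr//.
  have := le_trans (ler_norm _) (fb (x + t *: y)); rewrite fD fZ fx; lra.
apply/funext => y; apply/eqP; rewrite eq_le H/=.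
by have := H (- y); rewrite norm_derivN// -scaleN1r fZ; lra.
Qed.

Lemma is_derive_norm x y l : x + l *: y != 0 ->
  is_derive l 1 (fun t : R => `|x + t *: y| : R) (norm_deriv (x + l *: y) y).
Proof.
set p := x + _ => p0.
(* [norm_deriv p] is a subgradient at [p]; with the second difference bound this squeezes the
   two-sided difference quotient. *)
have low t : t * norm_deriv p y <= `|p + t *: y| - `|p|.
  case: (ltgtP t 0) => [t0|t0|->]; last by rewrite scale0r addr0 subrr mul0r.
    have t0' : 0 < - t by rewrite oppr_gt0.
    have := norm_deriv_le p (- y) _ t0'; rewrite norm_derivN// /slope ler_pdivlMr//.
    by rewrite scaleNr scalerN (opprK (t *: y)); lra.
  have := norm_deriv_le p y _ t0; rewrite /slope ler_pdivlMr//; lra.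
have C : (fun h : R => h^-1 *: (`|x + (h *: 1 + l) *: y| - `|p|)) @ 0^' -->
    (norm_deriv p y : R).
  apply/cvgrPdist_le => e e0; have [d d0 H] := smooth_slope p y e p0 e0.
  exists d => //= h; rewrite /ball/= sub0r normrN => hd h0.
  have -> : x + (h *: 1 + l) *: y = p + h *: y.
    by rewrite [h *: 1]mulr1 scalerDl addrA addrAC.
  have := low h; have := low (- h).
  have := H `|h|; rewrite normr_gt0 h0 hd => /(_ isT); rewrite /slope.
  have -> : h^-1 *: (`|p + h *: y| - `|p|) = slope p y h by rewrite /slope mulrC.
  have sandwich (u v : R) : u - e <= v -> v <= u + e -> - e <= u - v <= e.
    by move=> *; apply/andP; split; lra.
  rewrite /slope ler_norml; case: (ltgtP h 0) (h0) => // hs _.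
    rewrite ltr0_norm// !scaleNr !scalerN !(opprK (h *: y)).
    set A := `|p - h *: y|; set B := `|p + h *: y|.
    rewrite -mulrDl ler_pdivrMr ?oppr_gt0// => h1 h2 h3.
    have -> : (B - `|p|) / h = (`|p| - B) / (- h) by field; rewrite lt_eqF.
    apply: sandwich; first by rewrite ler_pdivlMr ?oppr_gt0//; nra.
    by rewrite ler_pdivrMr ?oppr_gt0//; nra.
  rewrite gtr0_norm// !scalerN !scaleNr.
  set A := `|p - h *: y|; set B := `|p + h *: y|.
  rewrite -mulrDl ler_pdivrMr// => h1 h2 h3.
  apply: sandwich; first by rewrite ler_pdivlMr//; nra.
  by rewrite ler_pdivrMr//; nra.
by apply: DeriveDef; [apply/cvg_ex; exists (norm_deriv p y) | exact: cvg_lim].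
Qed.

End NormDerivative.

(** * The duality map *)

Section DualityMap.
Variables (R : realType) (X : completeNormedModType R).
Implicit Types (f : X -> R) (x y z w : X) (a b c t l : R).

(** * Bounded functionals and the dual norm *)

Lemma dual_eltD f x y : dual_elt f -> f (x + y) = f x + f y.
Proof. by move=> [fl _]; have := fl 1 1 x y; rewrite !scale1r !mul1r. Qed.

Lemma dual_eltZ f c x : dual_elt f -> f (c *: x) = c * f x.
Proof. by move=> [fl _]; have := fl c 0 x 0; rewrite scaler0 addr0 mul0r addr0. Qed.

Lemma dual_eltBZ f x c y : dual_elt f -> f (x - c *: y) = f x - c * f y.
Proof. by move=> fd; rewrite -scaleNr dual_eltD// dual_eltZ// mulNr. Qed.

Lemma dual_elt0 f : dual_elt f -> f 0 = 0.
Proof. by move=> fd; rewrite -(scale0r 0) dual_eltZ// mul0r. Qed.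

Lemma bounded_dual_elt f (C : R) : (forall x y, f (x + y) = f x + f y) ->
  (forall c x, f (c *: x) = c * f x) -> (forall x, `|f x| <= C * `|x|) -> dual_elt f.
Proof.
move=> fD fZ fb; split=> [a b x y|x]; first by rewrite fD !fZ.
apply/cvgrPdist_lt => e e0; near=> y.
have -> : f x - f y = f (x - y) by rewrite fD -[in RHS]scaleN1r fZ mulN1r.
apply: le_lt_trans (fb _) _.
have h : `|x - y| < e / (`|C| + 1).
  near: y; apply: cvgr_dist_lt; last by rewrite divr_gt0// ltr_wpDl.
  exact: cvg_id.
have C1 : 0 < `|C| + 1 by rewrite ltr_wpDl.
apply: le_lt_trans (_ : (`|C| + 1) * `|x - y| < e); last by rewrite mulrC -ltr_pdivlMr.
by rewrite ler_wpM2r// (le_trans (ler_norm C))// lerDl.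
Unshelve. all: by end_near. Qed.

Lemma dual_elt_bounded f : dual_elt f -> exists2 C, 0 <= C & forall x, `|f x| <= C * `|x|.
Proof.
move=> fd; have f0 := dual_elt0 _ fd.
have /cvgrPdist_lt /(_ 1 ltr01) := fd.2 0; rewrite f0 => /nbhs_ballP [d /= d0 H].
exists (2 / d); first by rewrite divr_ge0// ltW.
move=> x; have [->|x0] := eqVneq x 0; first by rewrite f0 !normr0 mulr0.
have n0 : 0 < `|x| by rewrite normr_gt0.
have := H ((d / 2 / `|x|) *: x); rewrite -ball_normE /= sub0r normrN normrZ.
have k0 : 0 < d / 2 / `|x| by rewrite !divr_gt0.
rewrite gtr0_norm// divfK ?gt_eqF// => /(_ _)/wrap[]; first lra.
rewrite sub0r normrN dual_eltZ// normrM gtr0_norm//.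
rewrite mulrC -ltr_pdivlMr// mul1r => h; apply: le_trans (ltW h) _.
by rewrite le_eqVlt; apply/orP; left; apply/eqP; field; rewrite !gt_eqF.
Qed.

Lemma dnorm_has_sup f : dual_elt f ->
  has_sup [set `|f x| | x in [set x : X | `|x| <= 1]].
Proof.
move=> fd; have [C C0 H] := dual_elt_bounded _ fd; split.
  by exists `|f 0|, 0 => //=; rewrite normr0 ler01.
by exists C => _ [x /= x1 <-]; apply: le_trans (H x) _; rewrite ler_piMr.
Qed.

Lemma dnorm_le f x : dual_elt f -> `|f x| <= dnorm f * `|x|.
Proof.
move=> fd; have [->|x0] := eqVneq x 0; first by rewrite dual_elt0// !normr0 mulr0.
have n0 : 0 < `|x| by rewrite normr_gt0.
have : `|f (`|x|^-1 *: x)| <= dnorm f.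
  apply: ub_le_sup; first by case: (dnorm_has_sup _ fd).
  by exists (`|x|^-1 *: x) => //=; rewrite normrZ normfV normr_id mulVf ?gt_eqF.
by rewrite dual_eltZ// normrM normfV normr_id mulrC ler_pdivrMr.
Qed.

Lemma dnorm_bound f C : 0 <= C -> (forall x, `|f x| <= C * `|x|) -> dnorm f <= C.
Proof.
move=> C0 H; apply: ge_sup; first by exists `|f 0|, 0 => //=; rewrite normr0 ler01.
by move=> _ [x /= x1 <-]; apply: le_trans (H x) _; rewrite ler_piMr.
Qed.

Lemma dual_norm_ge0 f : dual_elt f -> 0 <= dnorm f.
Proof.
move=> fd; apply: le_trans (normr_ge0 (f 0)) _.
apply: ub_le_sup; first by case: (dnorm_has_sup _ fd).
by exists 0 => //=; rewrite normr0 ler01.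
Qed.

Lemma dual_elt_scale f c : dual_elt f -> dual_elt (fun y => c * f y).
Proof.
move=> fd; have [C C0 H] := dual_elt_bounded _ fd.
apply: (bounded_dual_elt _ (`|c| * C)).
- by move=> x y; rewrite dual_eltD// mulrDr.
- by move=> b x; rewrite dual_eltZ// mulrCA.
- by move=> x; rewrite normrM -mulrA ler_wpM2l.
Qed.

Lemma dnorm_scale f c : dual_elt f -> dnorm (fun y => c * f y) = `|c| * dnorm f.
Proof.
move=> fd; apply/eqP; rewrite eq_le; apply/andP; split.
  apply: dnorm_bound => [|x]; first by rewrite mulr_ge0 ?dual_norm_ge0.
  by rewrite normrM -mulrA ler_wpM2l ?dnorm_le.
have [->|c0] := eqVneq c 0.
  by rewrite normr0 mul0r; exact: dual_norm_ge0 (dual_elt_scale _ _ fd).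
have n0 : 0 < `|c| by rewrite normr_gt0.
rewrite mulrC -ler_pdivlMr//; apply: dnorm_bound => [|x].
  by rewrite divr_ge0//; exact: dual_norm_ge0 (dual_elt_scale _ _ fd).
rewrite mulrAC ler_pdivlMr// mulrC -normrM.
exact: (dnorm_le _ x (dual_elt_scale _ c fd)).
Qed.

(** * The duality map as a multiple of the norm derivative *)

Hypothesis smooth : uniformly_smooth X.

(** For [x != 0], uniqueness of the supporting functional leaves [xget] a single choice; for
    [x = 0], dual norm zero forces the zero functional. *)
Lemma duality_mapE x : duality_map x = (fun y => `|x| * norm_deriv R X x y).
Proof.
have [x0|x0] := eqVneq x 0.
  have E : (fun y => `|x| * norm_deriv R X x y) = (fun=> 0).
    by apply/funext => y; rewrite x0 normr0 mul0r.
  have d0 : dnorm ((fun=> 0) : X -> R) = 0.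
    apply/eqP; rewrite eq_le dual_norm_ge0 ?andbT.
      by apply: dnorm_bound => // y; rewrite normr0 mul0r.
    by apply: (bounded_dual_elt _ 0) => *; rewrite ?addr0 ?mulr0 ?normr0 ?mul0r.
  rewrite E; apply: xget_unique; last first.
    move=> f [fd [_ [_]]]; rewrite x0 normr0 expr0n/= => /esym/eqP.
    rewrite sqrf_eq0 => /eqP f0; apply/funext => y.
    by have := dnorm_le _ y fd; rewrite f0 mul0r normr_le0 => /eqP.
  split; last by rewrite d0 x0 !normr0 !mulr0 expr0n.
  by apply: (bounded_dual_elt _ 0) => *; rewrite ?addr0 ?mulr0 ?normr0 ?mul0r.
have n0 : 0 < `|x| by rewrite normr_gt0.
set g := (fun y => _).
have gb y : `|g y| <= `|x| * `|y|.
  by rewrite /g normrM normr_id ler_pM2l// norm_deriv_ler.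
have gx : g x = `|x| ^+ 2 by rewrite /g norm_derivxx expr2.
have gd : dual_elt g.
  apply: (bounded_dual_elt _ `|x|) => // *; rewrite /g ?norm_derivD// ?mulrDr//.
  by rewrite norm_derivZ// mulrCA.
have gn : dnorm g = `|x|.
  apply/eqP; rewrite eq_le dnorm_bound//= -(ler_pM2r n0) -expr2 -gx.
  exact: le_trans (ler_norm _) (dnorm_le _ _ gd).
apply: xget_unique; first by split=> //; rewrite gn gx -expr2.
move=> f [fd [fx [_ /esym/eqP]]]; rewrite eqrXn2 ?dual_norm_ge0// => /eqP fn.
suff E : (fun y => `|x|^-1 * f y) = norm_deriv R X x.
  by apply/funext => y; rewrite /g -E mulrA divff ?gt_eqF// mul1r.
apply: norm_deriv_uniq => //.
- by move=> y z; rewrite dual_eltD// mulrDr.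
- by move=> c y; rewrite dual_eltZ// mulrCA.
- move=> y; rewrite normrM normfV normr_id mulrC ler_pdivrMr// mulrC -fn.
  exact: dnorm_le.
- by rewrite fx fn mulrA mulVf ?gt_eqF// mul1r.
Qed.

Local Notation J := (@duality_map R X).

Lemma duality_map0 y : J 0 y = 0.
Proof. by rewrite duality_mapE normr0 mul0r. Qed.

Lemma duality_mapD x y z : J x (y + z) = J x y + J x z.
Proof.
have [->|x0] := eqVneq x 0; first by rewrite !duality_map0 addr0.
by rewrite duality_mapE norm_derivD// mulrDr.
Qed.

Lemma duality_mapZ x c y : J x (c *: y) = c * J x y.
Proof.
have [->|x0] := eqVneq x 0; first by rewrite !duality_map0 mulr0.
by rewrite duality_mapE norm_derivZ// mulrCA.
Qed.

Lemma duality_mapN x y : J x (- y) = - J x y.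
Proof. by rewrite -scaleN1r duality_mapZ mulN1r. Qed.

Lemma duality_mapBZ x y c z : J x (y - c *: z) = J x y - c * J x z.
Proof. by rewrite duality_mapD duality_mapN duality_mapZ. Qed.

Lemma duality_mapxx x : J x x = `|x| ^+ 2.
Proof. by rewrite duality_mapE norm_derivxx expr2. Qed.

Lemma duality_map_le x y : J x y <= `|x| * `|y|.
Proof.
have [->|x0] := eqVneq x 0; first by rewrite duality_map0 normr0 mul0r.
by rewrite duality_mapE ler_wpM2l// (le_trans (ler_norm _))// norm_deriv_ler.
Qed.

Lemma duality_map_ler x y : `|J x y| <= `|x| * `|y|.
Proof.
by rewrite ler_norml duality_map_le andbT lerNl -duality_mapN -[`|y|]normrN duality_map_le.
Qed.

Lemma duality_map_dual x : dual_elt (J x).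
Proof.
apply: (bounded_dual_elt _ `|x|); [exact: duality_mapD|exact: duality_mapZ|].
exact: duality_map_ler.
Qed.

Lemma duality_map_gt0 x : x != 0 -> 0 < J x x.
Proof. by move=> x0; rewrite duality_mapxx exprn_gt0// normr_gt0. Qed.

(** Negative [c] is covered because [Num.sg c] times the supporting functional at [x] supports the
    norm at [c x]. *)
Lemma duality_map_scale c x y : J (c *: x) y = c * J x y.
Proof.
have [->|c0] := eqVneq c 0; first by rewrite scale0r duality_map0 mul0r.
have [->|x0] := eqVneq x 0; first by rewrite scaler0 duality_map0 mulr0.
have cx0 : c *: x != 0 by rewrite scaler_eq0 negb_or c0.
have s1 : `|Num.sg c| = 1 by rewrite normr_sg c0.
rewrite !duality_mapE -(@norm_deriv_uniq _ _ _ _ (fun y => Num.sg c * norm_deriv R X x y))//.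
- by rewrite normrZ -{3}(mulr_sg_norm c); ring.
- by move=> u v; rewrite norm_derivD// mulrDr.
- by move=> b u; rewrite norm_derivZ// mulrCA.
- by move=> u; rewrite normrM s1 mul1r norm_deriv_ler.
- rewrite norm_derivZ// norm_derivxx mulrA normrZ; congr (_ * _).
  by rewrite -{2}(mulr_sg_norm c) mulrA -expr2 sqr_sg c0 mul1r.
Qed.

(** Monotonicity of [J], with [(J x - J y) (x - y)] expanded; the value is at least
    [(|x| - |y|)^2]. *)
Lemma duality_map_mono x y : 0 <= J x x - J x y - J y x + J y y.
Proof.
rewrite !duality_mapxx; have := duality_map_le x y; have := duality_map_le y x.
have := sqr_ge0 (`|x| - `|y|); rewrite sqrrB; lra.
Qed.

(* One-sided form of the equivalence between [J x w = 0] and Birkhoff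
   orthogonality of [x] to [w]. *)
Lemma duality_map_ge0P x w :
  (forall t, 0 < t -> `|x| <= `|x + t *: w|) <-> 0 <= J x w.
Proof.
split=> [H|H t t0].
  rewrite duality_mapE mulr_ge0//; apply: le_norm_deriv => t t0.
  by apply: divr_ge0 (ltW t0); rewrite subr_ge0 H.
have [->|x0] := eqVneq x 0; first by rewrite normr0.
have n0 : 0 < `|x| by rewrite normr_gt0.
rewrite -(ler_pM2l n0); apply: le_trans (duality_map_le _ _).
by rewrite duality_mapD duality_mapZ duality_mapxx expr2 lerDl mulr_ge0// ltW.
Qed.

End DualityMap.

(** * Left additive orthogonality *)

(** Nonnegativity makes [f] monotone; squeezing [n a] between consecutive integers, for [a >= 0],
    gives [|f a - a f 1| <= f 1 / n]. *)
Lemma additive_nonneg_linear (R : realType) (f : R -> R) :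
  (forall a b, f (a + b) = f a + f b) -> (forall a, 0 <= a -> 0 <= f a) ->
  forall a, f a = a * f 1.
Proof.
move=> fD f0.
have f00 : f 0 = 0 by have := fD 0 0; rewrite addr0; lra.
have fN a : f (- a) = - f a by have := fD a (- a); rewrite subrr f00; lra.
have fM n a : f (n%:R * a) = n%:R * f a.
  elim: n => [|n IH]; first by rewrite !mul0r f00.
  by rewrite -natr1 !mulrDl !mul1r fD IH.
have mono a b : a <= b -> f a <= f b.
  by move=> ab; rewrite -subr_ge0 -fN -fD f0// subr_ge0.
have f1 : 0 <= f 1 by apply: f0.
have pos a : 0 <= a -> f a = a * f 1.
  move=> a0; apply/eqP; rewrite -subr_eq0 -normr_le0.
  apply/ler_addgt0Pr => e e0; rewrite add0r.
  have [n hn] : exists n : nat, f 1 / e < n%:R.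
    by exists (Num.bound (f 1 / e)); apply: archi_boundP; rewrite divr_ge0// ltW.
  have n0 : 0 < n%:R :> R by apply: le_lt_trans hn; rewrite divr_ge0// ltW.
  have na0 : 0 <= n%:R * a by rewrite mulr_ge0// ltW.
  have /andP[m1 m2] := Num.Theory.truncn_itv na0.
  set m := Num.truncn (n%:R * a) in m1 m2.
  have h1 := mono _ _ m1; have h2 := mono _ _ (ltW m2).
  have e1 : f m%:R = m%:R * f 1 by rewrite -[in LHS](mulr1 m%:R) fM.
  have e2 : f m.+1%:R = m.+1%:R * f 1 by rewrite -[in LHS](mulr1 m.+1%:R) fM.
  rewrite e1 fM in h1; rewrite e2 fM -natr1 in h2.
  rewrite -natr1 in m2.
  rewrite -(ler_pM2l n0) -[in leLHS](gtr0_norm n0) -normrM.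
  rewrite ltr_pdivrMr// in hn.
  rewrite ler_norml; apply/andP; split; nra.
move=> a; case: (leP 0 a) => [|/ltW a0]; first exact: pos.
by have := pos (- a); rewrite fN oppr_ge0 => /(_ a0); lra.
Qed.

Section LeftAdditive.
Variables (R : realType) (X : completeNormedModType R).
Hypothesis smooth : uniformly_smooth X.
Implicit Types (x y z w : X) (a b c t l m : R).

Local Notation J := (@duality_map R X).

(** Take [t] minimizing [|x - t y|]: minimality in the directions [y] and [- y] bounds
    [J (x - t y) y] from both sides. *)
Lemma ex_orthogonal_shift x y : exists t, J (x - t *: y) y = 0.
Proof.
have [->|y0] := eqVneq y 0.
  by exists 0; rewrite (dual_elt0 _ _ _ (duality_map_dual _ _ smooth _)).
have n0 : 0 < `|y| by rewrite normr_gt0.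
pose g := (fun t : R => `|x - t *: y| : R).
(* Beyond [M] the norm exceeds its value at [t = 0], so a minimum over [[-M, M]] is global. *)
set M := 2 * `|x| / `|y|.
have M0 : 0 <= M by rewrite divr_ge0// mulr_ge0.
have gc : {within `[- M, M], continuous g}.
  apply: continuous_subspaceT => t; apply: cvg_norm; apply: cvgB; first exact: cvg_cst.
  exact: scalel_continuous.
have MM : - M <= M by lra.
have [c cM Hc] := EVT_min MM gc.
have H t : g c <= g t.
  case: (boolP (t \in `[- M, M])) => [|]; first exact: Hc.
  move=> tM; have g0 : g c <= `|x|.
    by have := Hc 0; rewrite /g scale0r subr0; apply; rewrite in_itv/= M0 oppr_le0 M0.
  apply: le_trans g0 _; rewrite /g.
  have : M < `|t|.
    rewrite ltNge; apply: contra tM => tM; rewrite in_itv/=.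
    by move: tM; rewrite ler_norml.
  rewrite /M ltr_pdivrMr// => h.
  have := ler_normB x (x - t *: y); rewrite opprB addrCA subrr addr0 normrZ; lra.
exists c; apply/eqP; rewrite eq_le; apply/andP; split.
  rewrite -oppr_ge0 -duality_mapN//; apply/duality_map_ge0P => // t _.
  have -> : x - c *: y + t *: (- y) = x - (c + t) *: y.
    by rewrite scalerN -addrA -opprD -scalerDl.
  exact: H.
apply/duality_map_ge0P => // t _.
have -> : x - c *: y + t *: y = x - (c - t) *: y by rewrite scalerBl opprB addrA addrAC.
exact: H.
Qed.

Lemma is_derive_norm_sqr_quot x y (q dq : R -> R) l :
  x + l *: y != 0 -> q l != 0 -> is_derive l 1 q (dq l) ->
  is_derive l 1 (fun t : R => `|x + t *: y| ^+ 2 / q t)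
    ((2 * J (x + l *: y) y * q l - `|x + l *: y| ^+ 2 * dq l) / q l ^+ 2).
Proof.
move=> p0 q0 dql.
have dn := is_derive_norm _ _ smooth x y l p0.
have dv := is_deriveV q0 dql.
apply: is_derive_eq (is_deriveM (is_deriveM dn dn) dv) _.
rewrite duality_mapE// /GRing.scale/= mulrfctE.
by field.
Qed.

Lemma MVT_is_derive (f df : R -> R) a b : a < b ->
  (forall l, is_derive l 1 f (df l)) -> exists c, f b - f a = df c * (b - a).
Proof.
move=> ab d; have [|c _ E] := @MVT R f df a b ab (fun l _ => d l); last by exists c.
apply/continuous_subspaceT => r.
exact/differentiable_continuous/derivable1_diffP.
Qed.

Hypothesis left_additive :
  forall x y w, J x w = 0 -> J y w = 0 -> J (x + y) w = 0.

Lemma left_additiveZ x y w l : J x w = 0 -> J y w = 0 -> J (x + l *: y) w = 0.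
Proof.
by move=> xw yw; apply: left_additive => //; rewrite duality_map_scale// yw mulr0.
Qed.

Lemma left_additiveZ_inv x y w l : J (x + l *: y) w = 0 -> J y w = 0 -> J x w = 0.
Proof.
move=> h yw; have := left_additiveZ _ _ _ (- l) h yw.
by rewrite scaleNr addrK.
Qed.

(** * The norm on a plane that has a common orthogonal vector *)

Section Plane.
Variables (x y z : X).
Hypotheses (x0 : x != 0) (y0 : y != 0) (z0 : z != 0).
Hypotheses (Jxy : J x y = 0) (Jzx : J z x = 0) (Jzy : J z y = 0).

(** [c0] measures the failure of symmetry and will be shown to vanish. It is chosen so that
    [J y u = 0], while [J x y = 0] leaves [J x u = J x x]. *)
Let c0 := J y x / J y y.
Let u := x - c0 *: y.

Let Jx_gt0 : 0 < J x x. Proof. exact: duality_map_gt0. Qed.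
Let Jy_gt0 : 0 < J y y. Proof. exact: duality_map_gt0. Qed.
Let Jz_gt0 : 0 < J z z. Proof. exact: duality_map_gt0. Qed.

Let JuE p : J p u = J p x - c0 * J p y.
Proof. exact: duality_mapBZ. Qed.

Let Jyu : J y u = 0.
Proof. by rewrite JuE /c0 divfK ?gt_eqF// subrr. Qed.

Let Jxu : J x u = J x x. Proof. by rewrite JuE Jxy mulr0 subr0. Qed.

Let Jzu : J z u = 0. Proof. by rewrite JuE Jzx Jzy mulr0 subr0. Qed.

(** Choose [t] with [J (x - t u) u = 0]. Adding [r y] keeps this zero, so monotonicity between
    [p = x + r y] and [p - t u] reads [0 <= t * J p u]. The case [r = 0] gives the sign of [t], and
    [J p u] cannot vanish since [J x u] does not. *)
Lemma plane_coord_gt0 l : 0 < J (x + l *: y) u.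
Proof.
have [t Jt] := ex_orthogonal_shift x u.
have H r : 0 <= t * J (x + r *: y) u.
  set p := x + r *: y; set q := p - t *: u.
  have Jq : J q u = 0 by rewrite /q /p addrAC left_additiveZ.
  have := duality_map_mono _ _ smooth p q.
  have E v : J v q = J v p - t * J v u.
    exact: duality_mapBZ.
  by rewrite (E p) (E q) Jq; lra.
have Jp0 r : J (x + r *: y) u != 0.
  apply/eqP => h; have := left_additiveZ_inv _ _ _ _ h Jyu.
  by rewrite Jxu => /eqP; rewrite gt_eqF.
have t0 : 0 < t.
  rewrite lt_neqAle; apply/andP; split.
    apply/eqP => t0; move: Jt; rewrite -t0 scale0r subr0 Jxu => /eqP.
    by rewrite gt_eqF.
  by have := H 0; rewrite scale0r addr0 Jxu pmulr_lge0.
by rewrite lt_neqAle eq_sym Jp0/= -(pmulr_rge0 _ t0) H.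
Qed.

Let sigma l := J (x + l *: y) y / J (x + l *: y) u.

(** The coordinates of the sum of [x + l y] and [z + m y] are computed from those of its terms; [z]
    provides the third dimension in which [l] and [m] vary independently. *)
Lemma sigmaD l m : sigma (l + m) = sigma l + sigma m.
Proof.
(* Solved in triangular order: since [J x y = 0], the equation [J x w = 0] fixes [a] alone, and
   [J y w = 0] then fixes [b]. *)
pose a := - J x z / J x x; pose b := - (J y z + a * J y x) / J y y.
pose w := z + a *: x + b *: y.
have JwE p : J p w = J p z + a * J p x + b * J p y.
  by rewrite !duality_mapD// !duality_mapZ.
have Jxw : J x w = 0 by rewrite JwE Jxy /a; field; rewrite gt_eqF.
have Jyw : J y w = 0 by rewrite JwE /b; field; rewrite gt_eqF.
have Jzw : J z w != 0 by rewrite JwE Jzx Jzy !mulr0 !addr0 gt_eqF.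
pose mu t := J (z + t *: y) y / J (z + t *: y) w.
have zw t : J (z + t *: y) w != 0.
  by apply: contra Jzw => /eqP h; apply/eqP; exact: left_additiveZ_inv h Jyw.
have xzu : J (x + z) u != 0.
  apply/eqP => h; have := left_additiveZ_inv x z u 1.
  by rewrite scale1r h Jxu => /(_ erefl Jzu)/eqP; rewrite gt_eqF.
have qu t : J (x + z + t *: y) u != 0.
  by apply: contra xzu => /eqP h; apply/eqP; exact: left_additiveZ_inv h Jyu.
(* This ratio is unchanged when multiples of [y] are added to [x + z], because [J y] kills both [u]
   and [w]. *)
pose r := J (x + z) w / J (x + z) u.
pose tau t := J (x + z + t *: y) y / J (x + z + t *: y) u.
have tauE l' m' : tau (l' + m') = sigma l' + r * mu m'.
  have qE : x + z + (l' + m') *: y = (x + l' *: y) + (z + m' *: y).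
    by rewrite scalerDl addrACA.
  have p0 : J (x + l' *: y) u != 0 by rewrite gt_eqF// plane_coord_gt0.
  have pw : J (x + l' *: y) w = 0 by apply: left_additiveZ.
  have zu : J (z + m' *: y) u = 0 by apply: left_additiveZ.
  (* The vector killed by both [J (x + l' y)], which vanishes at [w], and [J (z + m' y)], which
     vanishes at [u]; left additivity passes this to the sum. *)
  pose f := y - sigma l' *: u - mu m' *: w.
  have JfE p : J p f = J p y - sigma l' * J p u - mu m' * J p w.
    by rewrite (duality_mapBZ _ _ _ _ _ _ w)// (duality_mapBZ _ _ _ _ y _ u).
  have E1 : J (x + z + (l' + m') *: y) f = 0.
    by rewrite qE; apply: left_additive; rewrite JfE ?pw ?zu /sigma /mu; field; rewrite zw.
  pose g := w - r *: u.
  have JgE p : J p g = J p w - r * J p u.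
    exact: duality_mapBZ.
  have E2 : J (x + z + (l' + m') *: y) g = 0.
    apply: left_additiveZ; rewrite JgE ?Jyw ?Jyu; last by ring.
    by rewrite /r; field.
  have := qu (l' + m'); move: E1 E2; rewrite JfE JgE /tau.
  move: (J (_ + _) y) (J (_ + _) u) (J (_ + _) w) => A B C E1 E2 B0.
  have -> : A = (sigma l' + r * mu m') * B by move: E1; rewrite (subr0_eq E2); lra.
  by rewrite mulfK.
(* Setting either argument to zero in [tauE] shows [tau = sigma = r * mu], which turns [tauE] into
   additivity of [sigma]. *)
have s0 : sigma 0 = 0 by rewrite /sigma scale0r addr0 Jxy mul0r.
have m0 : mu 0 = 0 by rewrite /mu scale0r addr0 Jzy mul0r.
have tl t : tau t = sigma t by rewrite -[in LHS](addr0 t) tauE m0 mulr0 addr0.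
have tm t : tau t = r * mu t by rewrite -[in LHS](add0r t) tauE s0 add0r.
by rewrite -tl tauE -tm tl.
Qed.

Let k := sigma 1.

(** For [t > 0], monotonicity between [x + t y] and [x] reads [0 <= t * J (x + t y) y], so the
    additive [sigma] is nonnegative there and hence linear. *)
Lemma plane_coordE l : J (x + l *: y) y = k * l * J (x + l *: y) u.
Proof.
have p0 t : J (x + t *: y) u != 0 by rewrite gt_eqF// plane_coord_gt0.
have E : sigma l = l * sigma 1.
  apply: additive_nonneg_linear => [|t]; first exact: sigmaD.
  rewrite le_eqVlt => /predU1P[<-|t0]; first by rewrite /sigma scale0r addr0 Jxy mul0r.
  rewrite /sigma divr_ge0//; last exact/ltW/plane_coord_gt0.
  have := duality_map_mono _ _ smooth (x + t *: y) x.
  rewrite 2!(duality_mapD _ _ smooth _ x) !duality_mapZ// Jxy => h.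
  by rewrite -(pmulr_rge0 _ t0); lra.
by rewrite [k * l]mulrC /k -E /sigma divfK.
Qed.

(** If [k = 0], then [J (x + y) y = 0]; together with [J x y = 0] this would give [J y y = 0]. *)
Let k_gt0 : 0 < k.
Proof.
have := duality_map_mono _ _ smooth (x + 1 *: y) x.
rewrite 2!(duality_mapD _ _ smooth _ x) !duality_mapZ// Jxy => h.
have U0 := plane_coord_gt0 1; have V := plane_coordE 1; rewrite mulr1 in V.
have k0 : 0 <= k by rewrite -(pmulr_lge0 _ U0) -V; lra.
rewrite lt_neqAle k0 andbT; apply/eqP => k00.
have := left_additiveZ_inv y x y 1; rewrite scale1r addrC -[y in J (_ + y)]scale1r.
by rewrite V -k00 mul0r => /(_ erefl Jxy)/eqP; rewrite gt_eqF.
Qed.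

(** Arises from expanding [J p p] for [p = x + l y = u + (c0 + l) y] with [J p y = k l J p u]. *)
Let Q l := 1 + c0 * k * l + k * l ^+ 2.

Let norm_lineE l : `|x + l *: y| ^+ 2 = J (x + l *: y) u * Q l.
Proof.
rewrite -(duality_mapxx _ _ smooth).
have -> : J (x + l *: y) (x + l *: y) =
    J (x + l *: y) u + (c0 + l) * J (x + l *: y) y.
  by rewrite (duality_mapD _ _ smooth _ x) duality_mapZ// JuE; ring.
by rewrite plane_coordE /Q; ring.
Qed.

Let line_neq0 l : x + l *: y != 0.
Proof.
apply/eqP => h; have := plane_coord_gt0 l.
by rewrite h duality_map0// ltxx.
Qed.

Let Q_gt0 l : 0 < Q l.
Proof.
have := norm_lineE l; have U0 := plane_coord_gt0 l => E.
by rewrite -(pmulr_rgt0 _ U0) -E exprn_gt0// normr_gt0 line_neq0.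
Qed.

(** The reciprocal polynomial: [P m = m^2 Q (1 / m)] for [m != 0], matching
    [y + m x = m (x + y / m)]. *)
Let P m := m ^+ 2 + c0 * k * m + k.

(* The same information in the chart [y + m x] around the point at infinity of
   the line [x + l y]; the positive factor [v] plays the role of [J _ u]. *)
Let chart_at_infinity m : exists2 v, 0 < v &
  J (y + m *: x) x = (m + c0 * k) * v /\ `|y + m *: x| ^+ 2 = v * P m.
Proof.
(* At [m = 0] the vector is [y], which is not on the line [x + l y]; the factor is forced by
   [|y|^2 = v P(0) = v k]. *)
have [->|m0] := eqVneq m 0.
  exists (J y y / k); first by rewrite divr_gt0.
  rewrite scale0r addr0 -(duality_mapxx _ _ smooth) /P; split.
    by rewrite /c0; field; rewrite !gt_eqF.
  by field; rewrite gt_eqF.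
have E : y + m *: x = m *: (x + m^-1 *: y).
  by rewrite scalerDr scalerA divff// scale1r addrC.
exists (J (x + m^-1 *: y) u); first exact: plane_coord_gt0.
split.
  have H : J (x + m^-1 *: y) x = J (x + m^-1 *: y) u + c0 * J (x + m^-1 *: y) y.
    by rewrite JuE subrK.
  by rewrite E duality_map_scale// H plane_coordE; field.
rewrite E normrZ exprMn norm_lineE real_normK ?num_real// /Q /P.
by field.
Qed.

Let P_gt0 m : 0 < P m.
Proof.
have [->|m0] := eqVneq m 0; first by rewrite /P expr0n mulr0 !add0r.
have -> : P m = m ^+ 2 * Q m^-1 by rewrite /P /Q; field.
by rewrite mulr_gt0// exprn_even_gt0.
Qed.

Let is_derive_Q l : is_derive l 1 Q (c0 * k + 2 * k * l).
Proof.
rewrite /Q; apply: is_derive_eq.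
by rewrite /GRing.scale/=; ring.
Qed.

Let is_derive_P m : is_derive m 1 P (2 * m + c0 * k).
Proof.
rewrite /P; apply: is_derive_eq.
by rewrite /GRing.scale/=; ring.
Qed.

(** Equal to [J (x + l y) u], but written as a quotient whose derivative is available. *)
Let h l := `|x + l *: y| ^+ 2 / Q l.
Let h' m := `|y + m *: x| ^+ 2 / P m.

(** The [2 k l] terms of [2 J p y] and of the derivative of [Q] cancel; what remains has the sign of
    [- c0]. *)
Let is_derive_h l : is_derive l 1 h (- (c0 * k) * (J (x + l *: y) u / Q l)).
Proof.
apply: is_derive_eq (is_derive_norm_sqr_quot _ _ _ (fun t => c0 * k + 2 * k * t) _
  (line_neq0 l) (lt0r_neq0 (Q_gt0 l)) (is_derive_Q l)) _.
rewrite plane_coordE norm_lineE; have := lt0r_neq0 (Q_gt0 l).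
by rewrite /Q => q0; field.
Qed.

Let is_derive_h' m : exists2 v, 0 < v & is_derive m 1 h' (c0 * k * (v / P m)).
Proof.
have [v v0 [E1 E2]] := chart_at_infinity m; exists v => //.
have n0 : y + m *: x != 0.
  have := mulr_gt0 v0 (P_gt0 m); rewrite -E2.
  by apply: contraL => /eqP ->; rewrite normr0 expr0n ltxx.
apply: is_derive_eq (is_derive_norm_sqr_quot _ _ _ (fun t => 2 * t + c0 * k) _
  n0 (lt0r_neq0 (P_gt0 m)) (is_derive_P m)) _.
rewrite E1 E2; have := lt0r_neq0 (P_gt0 m).
by rewrite /P => q0; field.
Qed.

(* On [-1, 1] both charts give the same increment of the quotient, while its
   derivatives in the two charts have opposite signs. *)
Let c0_eq0 : c0 = 0.
Proof.
have /choice [v hv] : forall m, exists v, 0 < v /\ is_derive m 1 h' (c0 * k * (v / P m)).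
  by move=> m; have [v v0 d] := is_derive_h' m; exists v.
have N : (-1 : R) < 1 by lra.
have [a Ea] := MVT_is_derive _ _ _ _ N is_derive_h.
have [b Eb] := MVT_is_derive _ _ _ _ N (fun m => (hv m).2).
(* At the parameters [1] and [-1] the charts give the same vector up to sign, and [P] and [Q]
   agree. *)
have h1 : h 1 = h' 1 by rewrite /h /h' /Q /P !scale1r (addrC x); congr (_ / _); ring.
have hN1 : h (-1) = h' (-1).
  rewrite /h /h' /Q /P !scaleN1r -opprB normrN; congr (_ / _); ring.
have A0 : 0 < J (x + a *: y) u / Q a by rewrite divr_gt0 ?plane_coord_gt0.
have B0 : 0 < v b / P b by rewrite divr_gt0// (hv b).1.
have : c0 * k * (J (x + a *: y) u / Q a + v b / P b) = 0.
  by move: Ea Eb; rewrite h1 hN1; lra.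
move/eqP; rewrite mulf_eq0 (gt_eqF (addr_gt0 A0 B0)) orbF.
by rewrite mulf_eq0 (gt_eqF k_gt0) orbF => /eqP.
Qed.

Lemma orthogonal_sym : J y x = 0.
Proof. by move: c0_eq0 => /eqP; rewrite mulf_eq0 invr_eq0 (gt_eqF Jy_gt0) orbF => /eqP. Qed.

(** With [c0 = 0] both quotients are constant; they agree at [1], and the common value [J y y / k]
    is read off at [y] itself. *)
Lemma duality_map_line l : J (x + l *: y) y = l * J y y.
Proof.
have hc a b : h a = h b.
  apply: is_derive_0_is_cst => t; apply: is_derive_eq (is_derive_h t) _.
  by rewrite c0_eq0 !mul0r oppr0 mul0r.
have hc' a b : h' a = h' b.
  apply: is_derive_0_is_cst => t; have [v _ d] := is_derive_h' t.
  by apply: is_derive_eq d _; rewrite c0_eq0 !mul0r.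
have h1 : h 1 = h' 1 by rewrite /h /h' /Q /P !scale1r (addrC x); congr (_ / _); ring.
have hE a : h a = J (x + a *: y) u by rewrite /h norm_lineE mulfK// gt_eqF.
have h0' : h' 0 = J y y / k.
  by rewrite /h' /P scale0r addr0 -(duality_mapxx _ _ smooth) expr0n mulr0 !add0r.
by rewrite plane_coordE -hE (hc l 1) h1 (hc' 1 0) h0'; field; rewrite gt_eqF.
Qed.

End Plane.

Hypothesis dim3 : dim_ge3 X.

(** By left additivity the shift coefficients behave linearly: a combination of [e1], [e2], [e3] is
    orthogonal to [x] and [y] once both of its combined coefficients vanish. Two linear equations in
    three unknowns have a nonzero solution. *)
Lemma ex_common_orthogonal x y : exists2 z, z != 0 & J z x = 0 /\ J z y = 0.
Proof.
have [e1 [e2 [e3 ind]]] := dim3.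
have [t ht] := choice (fun e => ex_orthogonal_shift e x).
have [r hr] := choice (fun e => ex_orthogonal_shift e y).
have comb (s : X -> R) w a b c : (forall e, J (e - s e *: w) w = 0) ->
    a * s e1 + b * s e2 + c * s e3 = 0 ->
    J (a *: e1 + b *: e2 + c *: e3) w = 0.
  move=> hs s0.
  have -> : a *: e1 + b *: e2 + c *: e3 = a *: (e1 - s e1 *: w) +
      b *: (e2 - s e2 *: w) + c *: (e3 - s e3 *: w).
    rewrite !scalerBr !scalerA (addrACA (a *: e1)) -opprD [in RHS]addrACA -opprD -!scalerDl s0.
    by rewrite scale0r subr0.
  by do 2!apply: left_additiveZ => //; rewrite duality_map_scale// hs mulr0.
suff [a [b [c [nz E1 E2]]]] : exists a b c : R, [/\ ~ [/\ a = 0, b = 0 & c = 0],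
    a * t e1 + b * t e2 + c * t e3 = 0 & a * r e1 + b * r e2 + c * r e3 = 0].
  exists (a *: e1 + b *: e2 + c *: e3); last by split; apply: comb; eassumption.
  by apply/eqP => /ind.
move: (t e1) (t e2) (t e3) (r e1) (r e2) (r e3) => t1 t2 t3 r1 r2 r3.
(* The cross product of the two rows solves the system; if it is zero, the rows are dependent and
   their first two entries provide a solution. *)
have [c10|c10] := eqVneq (t2 * r3 - t3 * r2) 0; last first.
  exists (t2 * r3 - t3 * r2), (t3 * r1 - t1 * r3), (t1 * r2 - t2 * r1).
  by split; [case=> /eqP; rewrite (negPf c10)|ring|ring].
have [c20|c20] := eqVneq (t3 * r1 - t1 * r3) 0; last first.
  exists (t2 * r3 - t3 * r2), (t3 * r1 - t1 * r3), (t1 * r2 - t2 * r1).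
  by split; [case=> _ /eqP; rewrite (negPf c20)|ring|ring].
have [c30|c30] := eqVneq (t1 * r2 - t2 * r1) 0; last first.
  exists (t2 * r3 - t3 * r2), (t3 * r1 - t1 * r3), (t1 * r2 - t2 * r1).
  by split; [case=> _ _ /eqP; rewrite (negPf c30)|ring|ring].
have [t10|t10] := eqVneq t1 0; last first.
  by exists t2, (- t1), 0; split; [case=> _ /eqP; rewrite oppr_eq0 (negPf t10)|ring|lra].
have [t20|t20] := eqVneq t2 0; last first.
  by exists t2, (- t1), 0; split; [case=> /eqP; rewrite (negPf t20)|ring|lra].
have [r10|r10] := eqVneq r1 0; last first.
  by exists r2, (- r1), 0; split; [case=> _ /eqP; rewrite oppr_eq0 (negPf r10)|lra|ring].
by exists 1, 0, 0; split; [case=> /eqP; rewrite oner_eq0|lra|lra].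
Qed.

(** Write [x = p + t y] with [p] orthogonal to [y]. Both sides equal [t * J y y]: one by
    [orthogonal_sym], the other by [duality_map_line]. *)
Lemma duality_map_sym x y : J x y = J y x.
Proof.
have [->|y0] := eqVneq y 0.
  by rewrite duality_map0// (dual_elt0 _ _ _ (duality_map_dual _ _ smooth _)).
have [t Jt] := ex_orthogonal_shift x y.
set p := x - t *: y in Jt.
have E : x = p + t *: y by rewrite subrK.
have Jyx : J y x = J y p + t * J y y by rewrite E duality_mapD// duality_mapZ.
have [p0|p0] := eqVneq p 0.
  rewrite Jyx E p0 add0r duality_map_scale//.
  by rewrite (dual_elt0 _ _ _ (duality_map_dual _ _ smooth _)) add0r.
have [z z0 [Jzp Jzy]] := ex_common_orthogonal p y.
rewrite Jyx (orthogonal_sym p y z)// add0r {1}E.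
exact: (duality_map_line p y z).
Qed.

End LeftAdditive.

(** * Metric projections *)

Section MetricProjection.
Variables (R : realType) (X : completeNormedModType R).
Hypothesis uc : uniformly_convex X.
Implicit Types (C K M : set X) (x y c : X).

(** Rescaling by [1 / r], with one [d] for all radii up to [r0]; the cap at [2] keeps the argument
    in the range where [uc] applies. *)
Lemma uniformly_convex_scaled (e r0 : R) : 0 < e -> 0 < r0 ->
  exists2 d, 0 < d & forall (r : R) (u v : X), 0 < r <= r0 ->
    `|u| <= r -> `|v| <= r -> e <= `|u - v| -> `|2^-1 *: (u + v)| <= r * (1 - d).
Proof.
move=> e0 r00.
have h : 0 < Num.min (e / r0) 2 <= 2.
  by rewrite lt_min divr_gt0//= ltr0n/= ge_min lexx orbT.
have [d d0 H] := uc _ h; exists d => // r u v /andP[rp rr0] ur vr uv.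
have sc w : `|r^-1 *: w| = `|w| / r by rewrite normrZ gtr0_norm ?invr_gt0// mulrC.
have := H (r^-1 *: u) (r^-1 *: v); rewrite -scalerBr -scalerDr scalerA.
rewrite (mulrC 2^-1) -scalerA !sc !ler_pdivrMr// !mul1r => /(_ ur vr).
rewrite (mulrC r); apply.
rewrite ge_min; apply/orP; left; apply: le_trans (_ : e / r <= _).
  by rewrite ler_pM2l// lef_pV2.
by rewrite ler_pM2r// invr_gt0.
Qed.

(** * Nearest points in closed midpoint convex sets *)

Section Midconvex.
Variable C : set X.
Hypothesis midC : forall c c', C c -> C c' -> C (2^-1 *: (c + c')).

Let midpointE x c c' : x - 2^-1 *: (c + c') = 2^-1 *: ((x - c) + (x - c')).
Proof.
have xx : 2^-1 *: (x + x) = x.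
  rewrite -[x in x + _]scale1r -[x in _ + x]scale1r -scalerDl scalerA.
  by rewrite (_ : 2^-1 * (1 + 1) = 1) ?scale1r//; field.
by rewrite addrACA -opprD scalerBr xx.
Qed.

(** Two almost nearest points far apart would have a midpoint at distance less than [d] from [x].
    For [d = 0] the triangle inequality suffices. *)
Lemma almost_nearest_close x (d e : R) : 0 <= d ->
    (forall c, C c -> d <= `|x - c|) -> 0 < e ->
  exists2 eta, 0 < eta & forall c c', C c -> C c' ->
    `|x - c| <= d + eta -> `|x - c'| <= d + eta -> `|c - c'| < e.
Proof.
move=> d_ge0 dlb e0.
have dE c c' : `|c - c'| = `|(x - c) - (x - c')|.
  by rewrite opprB [in RHS]addrC addrA addrNK distrC.
have [d0|d0] := eqVneq d 0.
  exists (e / 3) => [|c c' Cc Cc']; first by rewrite divr_gt0.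
  rewrite d0 add0r (dE c) => h h'.
  apply: le_lt_trans (ler_normB _ _) _; lra.
have dp : 0 < d by rewrite lt_neqAle eq_sym d0.
have [k k0 H] := uniformly_convex_scaled e (d + 1) e0 (ltr_wpDl d_ge0 ltr01).
(* The bound [1] keeps the radius below [d + 1]; the bound [d k / 2] gives
   [(d + eta) (1 - k) < d]. *)
exists (Num.min 1 (d * k / 2)); first by rewrite lt_min ltr01 !mulr_gt0// invr_gt0.
set eta := Num.min _ _.
have eta0 : 0 < eta by rewrite lt_min ltr01 !mulr_gt0// invr_gt0.
have eta1 : eta <= 1 by rewrite ge_min lexx.
have eta2 : eta <= d * k / 2 by rewrite ge_min lexx orbT.
move=> c c' Cc Cc' h h'; rewrite ltNge; apply/negP; rewrite dE => cc'.
have r : 0 < d + eta <= d + 1 by rewrite lerD2l eta1 addr_gt0.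
have := H _ _ _ r h h' cc'; rewrite -midpointE => h2.
have := dlb _ (midC _ _ Cc Cc').
have : 0 < d * k by rewrite mulr_gt0.
have : 0 < eta * k by rewrite mulr_gt0.
lra.
Qed.

Hypotheses (closedC : closed C) (C0 : C !=set0).

(** A minimizing sequence is Cauchy by [almost_nearest_close], and its limit stays in the closed set
    [C]. *)
Lemma ex_nearest x : exists2 c, C c & forall c', C c' -> `|x - c| <= `|x - c'|.
Proof.
pose D := [set `|x - c| | c in C]; pose d := inf D.
have D0 : D !=set0 by have [c Cc] := C0; exists `|x - c|, c.
have lb : has_lbound D by exists 0 => _ [c _ <-].
have dlb c : C c -> d <= `|x - c| by move=> Cc; apply: ge_inf => //; exists c.
have d_ge0 : 0 <= d by apply: lb_le_inf => // _ [c _ <-].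
have /choice [s hs] : forall n : nat, exists c, C c /\ `|x - c| < d + n.+1%:R^-1.
  move=> n; have n0 : 0 < n.+1%:R^-1 :> R by rewrite invr_gt0.
  have [_ [c Cc <-] h] := inf_adherent n0 (conj D0 lb).
  by exists c.
have close eta : 0 < eta -> \forall n \near \oo, `|x - s n| <= d + eta.
  move=> eta0; near=> n; apply: le_trans (ltW (hs n).2) _; rewrite lerD2l ltW//.
  by near: n; exact: near_infty_natSinv_lt (PosNum eta0).
have cs : cvg (s @ \oo).
  apply/cauchy_cvgP; apply: cauchy_exP => e e0.
  have [eta eta0 H] := almost_nearest_close x d e d_ge0 dlb e0.
  have [N _ HN] := close _ eta0.
  exists (s N); exists N => // n Nn; rewrite -ball_normE /=.
  by apply: H; [exact: (hs _).1|exact: (hs _).1|apply: HN => /=|exact: HN].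
exists (lim (s @ \oo)).
  by apply: (closed_cvg C closedC _ _ cs); near=> n; exact: (hs n).1.
move=> c' Cc'; apply: le_trans (dlb _ Cc').
apply/ler_addgt0Pr => e e0; have e2 : 0 < e / 2 by rewrite divr_gt0.
have /cvgrPdist_le /(_ _ e2) cl := cs.
have [n [h1 h2]] := @filter_ex _ _ _ _ (filterI cl (close _ e2)).
have := ler_normD (x - s n) (s n - lim (s @ \oo)); rewrite addrA subrK.
rewrite [`|s n - _|]distrC; lra.
Unshelve. all: by end_near. Qed.

Lemma metric_projP x :
  C (metric_proj C x) /\ forall c', C c' -> `|x - metric_proj C x| <= `|x - c'|.
Proof.
have [c Cc Hc] := ex_nearest x.
exact: (@xgetI _ 0 [set c | C c /\ forall c', C c' -> `|x - c| <= `|x - c'|] c).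
Qed.

Lemma metric_projE x c : C c -> (forall c', C c' -> `|x - c| <= `|x - c'|) ->
  metric_proj C x = c.
Proof.
move=> Cc Hc; apply: xget_unique => // c' [Cc' Hc'].
apply: contrapT => /eqP cc'.
have e0 : 0 < `|c' - c| by rewrite normr_gt0 subr_eq0.
have [eta eta0 H] := almost_nearest_close x _ _ (normr_ge0 (x - c)) Hc e0.
suff : `|c' - c| < `|c' - c| by rewrite ltxx.
apply: H => //; last by rewrite lerDl ltW.
by rewrite (le_trans (Hc' _ Cc))// lerDl ltW.
Qed.

End Midconvex.

(** * Polars, projections and surjectivity in terms of the duality map *)

Hypothesis smooth : uniformly_smooth X.

Local Notation J := (@duality_map R X).

Lemma cone_mid K : nonempty_closed_convex_cone K ->
  forall c c', K c -> K c' -> K (2^-1 *: (c + c')).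
Proof. by move=> [_ _ KZ KD] c c' Kc Kc'; apply: KZ; [rewrite invr_ge0|exact: KD]. Qed.

Lemma polar_coneP K x : nonempty_closed_convex_cone K ->
  polar K x <-> forall k, K k -> J x k <= 0.
Proof.
move=> hK; have [K0 Kcl KZ KD] := hK; split=> [Px k Kk|H].
  rewrite -oppr_ge0 -duality_mapN//; apply/duality_map_ge0P => // t t0.
  have [_ Hm] := metric_projP _ (cone_mid _ hK) Kcl K0 x.
  have := Hm (t *: k) (KZ _ _ (ltW t0) Kk).
  by rewrite (Px : metric_proj K x = 0) subr0 scalerN.
apply: metric_projE; first exact: cone_mid.
  by have [k Kk] := K0; rewrite -(scale0r k); exact: KZ.
move=> k Kk; rewrite subr0 -[k in leRHS]scale1r -scalerN.
by apply: (duality_map_ge0P _ _ _ _ _).2 => //; rewrite duality_mapN// oppr_ge0 H.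
Qed.

Lemma subspace_cone M : closed_subspace M -> nonempty_closed_convex_cone M.
Proof.
move=> [Mcl M0 MD]; split=> // [|l x _ Mx|x y Mx My]; first by exists 0.
  by have := MD l 0 x x Mx Mx; rewrite scale0r addr0.
by have := MD 1 1 x y Mx My; rewrite !scale1r.
Qed.

Lemma metric_proj_subspaceP M x p : closed_subspace M ->
  metric_proj M x = p <-> M p /\ forall m, M m -> J (x - p) m = 0.
Proof.
move=> hM; have [Mcl M0 MD] := hM; have hK := subspace_cone _ hM.
have MZ l m : M m -> M (l *: m).
  by move=> Mm; have := MD l 0 m m Mm Mm; rewrite scale0r addr0.
have MA m m' : M m -> M m' -> M (m + m') by case: hK => _ _ _; apply.
split=> [<-|[Mp H]].
  have [Mp Hm] := metric_projP _ (cone_mid _ hK) Mcl (ex_intro _ 0 M0) x.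
  split=> // m Mm.
  have H m' : M m' -> 0 <= J (x - metric_proj M x) m'.
    move=> Mm'; apply/duality_map_ge0P => // t t0.
    have -> : x - metric_proj M x + t *: m' = x - (metric_proj M x + (- t) *: m').
      by rewrite scaleNr opprB addrCA addrC.
    by apply: Hm; apply: MA => //; exact: MZ.
  have := H _ (MZ (-1) _ Mm); rewrite duality_mapZ// mulN1r oppr_ge0 => Jle.
  by apply/eqP; rewrite eq_le Jle H.
apply: metric_projE; [exact: cone_mid|by []|move=> m Mm].
have -> : x - m = x - p + 1 *: (p - m) by rewrite scale1r addrA subrK.
apply: (duality_map_ge0P _ _ _ _ _).2 => //.
by rewrite H// -(scaleN1r m); apply: MA => //; exact: MZ.
Qed.

Lemma dual_kernel_closed (f : X -> R) : dual_elt f -> closed_subspace [set x | f x = 0].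
Proof.
move=> fd; split=> [||a b x y /= fx fy]; last by rewrite fd.1 fx fy !mulr0 addr0.
  apply: (@preimage_closed _ _ f [set 0]) => [x _|]; first exact: fd.2.
  exact: closed_eq.
exact: dual_elt0.
Qed.

(** Riesz argument: for [x] outside the kernel of [f], the residual [z] of its projection has [J z]
    zero on that kernel, so [f] is a multiple of [J z]. *)
Lemma duality_map_surj (f : X -> R) : dual_elt f -> exists x, J x = f.
Proof.
move=> fd; have [f0|] := pselect (forall x, f x = 0).
  by exists 0; apply/funext => y; rewrite duality_map0// f0.
move=> /existsNP [x /eqP fx].
have hM := dual_kernel_closed _ fd; set M := [set x | f x = 0] in hM.
have [Mp H] := (metric_proj_subspaceP M x _ hM).1 erefl.
set z := x - _ in H.
have fz : f z = f x.
  by rewrite /z -(scale1r (metric_proj M x)) dual_eltBZ// Mp mulr0 subr0.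
have z0 : z != 0 by apply: contra_neq fx => z0; rewrite -fz z0 dual_elt0.
exists ((f z / J z z) *: z); apply/funext => y.
have Jz0 : J z z != 0 by rewrite gt_eqF// duality_map_gt0.
have fz0 : f z != 0 by rewrite fz.
have : J z (y - (f y / f z) *: z) = 0.
  by apply: H; rewrite /M /= dual_eltBZ// divfK// subrr.
rewrite duality_mapBZ// duality_map_scale// => /subr0_eq ->.
by move: (f z) (J z z) (f y) fz0 Jz0 => a b c a0 b0; field; rewrite a0.
Qed.

End MetricProjection.

(** * The implications *)

Section Equivalences.
Variables (R : realType) (X : completeNormedModType R).
Hypotheses (uc : uniformly_convex X) (smooth : uniformly_smooth X).
Implicit Types (x y z w : X) (a b c t l : R).

Local Notation J := (@duality_map R X).

Lemma dnorm_duality_map x : dnorm (J x) = `|x|.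
Proof.
have Jd := duality_map_dual _ _ smooth x.
apply/eqP; rewrite eq_le; apply/andP; split.
  exact: dnorm_bound (duality_map_ler _ _ smooth x).
have [->|x0] := eqVneq x 0.
  by rewrite normr0; exact: (dual_norm_ge0 _ _ _ (duality_map_dual _ _ smooth _)).
have n0 : 0 < `|x| by rewrite normr_gt0.
rewrite -(ler_pM2r n0) -expr2 -(duality_mapxx _ _ smooth).
exact: le_trans (ler_norm _) (dnorm_le _ _ _ _ Jd).
Qed.

Lemma dnorm_normalized_duality_map x : x != 0 ->
  dual_elt (fun y => `|x|^-1 * J x y) /\ dnorm (fun y => `|x|^-1 * J x y) = 1.
Proof.
move=> x0; have Jd := duality_map_dual _ _ smooth x.
split; first exact: dual_elt_scale.
by rewrite dnorm_scale// dnorm_duality_map normfV normr_id mulVf// normr_eq0.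
Qed.

Lemma duality_map_hyperplane x : x != 0 -> closed_hyperplane [set y | J x y = 0].
Proof.
move=> x0; exists (fun y => `|x|^-1 * J x y); first exact: dnorm_normalized_duality_map.
apply/seteqP; split=> y /= => [->|/eqP]; first by rewrite mulr0.
by rewrite mulf_eq0 invr_eq0 normr_eq0 (negPf x0) => /eqP.
Qed.

Lemma duality_map_halfspace x : x != 0 -> closed_halfspace [set y | J x y <= 0].
Proof.
move=> x0; exists (fun y => `|x|^-1 * J x y); first exact: dnorm_normalized_duality_map.
by right; apply/seteqP; split=> y /=; rewrite pmulr_rle0// invr_gt0 normr_gt0.
Qed.

Lemma closed_hyperplane_subspace H : @closed_hyperplane R X H -> closed_subspace H.
Proof. by move=> [a [ad _] ->]; exact: dual_kernel_closed. Qed.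

Lemma closed_subspaceI (M N : set X) :
  closed_subspace M -> closed_subspace N -> closed_subspace (M `&` N).
Proof.
move=> [Mc M0 ML] [Nc N0 NL]; split=> [|//|a b x y [Mx Nx] [My Ny]].
  exact: closedI.
by split; [exact: ML|exact: NL].
Qed.

Lemma closed_halfspace_cone S : @closed_halfspace R X S -> nonempty_closed_convex_cone S.
Proof.
have cont (a : X -> R) (D : set R) : dual_elt a -> closed D -> closed (a @^-1` D).
  by move=> ad Dc; apply: preimage_closed => // x _; exact: ad.2.
move=> [a [ad _] [] ->]; split.
- by exists 0; rewrite /= dual_elt0.
- exact: (cont a [set t | 0 <= t] ad (@closed_ge _ 0)).
- by move=> l x l0 /= ax; rewrite dual_eltZ// mulr_ge0.
- by move=> x y /= ax ay; rewrite dual_eltD// addr_ge0.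
- by exists 0; rewrite /= dual_elt0.
- exact: (cont a [set t | t <= 0] ad (@closed_le _ 0)).
- by move=> l x l0 /= ax; rewrite dual_eltZ// mulr_ge0_le0.
- by move=> x y /= ax ay; rewrite dual_eltD//; lra.
Qed.

Lemma coneI (K L : set X) : nonempty_closed_convex_cone K ->
  nonempty_closed_convex_cone L -> nonempty_closed_convex_cone (K `&` L).
Proof.
move=> [[k Kk] Kc KZ KD] [[l Ll] Lc LZ LD]; split.
- exists 0; split; first by rewrite -(scale0r k); exact: KZ.
  by rewrite -(scale0r l); exact: LZ.
- exact: closedI.
- by move=> a x a0 [Kx Lx]; split; [exact: KZ|exact: LZ].
- by move=> x y [Kx Lx] [Ky Ly]; split; [exact: KD|exact: LD].
Qed.

(** Equal functionals force equal norms and value [|x|^2] at the midpoint, whose norm is then at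
    least [|x|]; uniform convexity forbids this for [x != y]. *)
Lemma duality_map_inj x y : (forall z, J x z = J y z) -> x = y.
Proof.
move=> E; apply: contrapT => /eqP xy.
have e0 : 0 < `|x - y| by rewrite normr_gt0 subr_eq0.
have nE : `|x| = `|y|.
  have h1 := duality_map_le _ _ smooth x y; have h2 := duality_map_le _ _ smooth y x.
  move: h1 h2; rewrite E -(E x) !duality_mapxx// !expr2 => h1 h2.
  have := normr_ge0 x; have := normr_ge0 y; nra.
have x0 : 0 < `|x|.
  rewrite normr_gt0; apply/eqP => x0; move/eqP: xy; apply.
  by apply/esym/eqP; rewrite x0 -normr_eq0 -nE x0 normr0.
have [d d0 H] := uniformly_convex_scaled _ _ uc _ _ e0 x0.
have r : 0 < `|x| <= `|x| by rewrite x0 lexx.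
have := H `|x| x y r (lexx _); rewrite nE lexx -nE => /(_ isT (lexx _)).
have := duality_map_le _ _ smooth x (2^-1 *: (x + y)).
rewrite duality_mapZ// duality_mapD// (E y) !duality_mapxx// -nE.
have -> : 2^-1 * (`|x| ^+ 2 + `|x| ^+ 2) = `|x| * `|x| by field.
rewrite ler_pM2l// => h1 h2; have := mulr_gt0 x0 d0; lra.
Qed.

(** * Left additivity from the geometric assertions *)

Definition left_additive_orthogonality :=
  forall x y w, J x w = 0 -> J y w = 0 -> J (x + y) w = 0.

(** Both [x] and [y] project to [0] on the intersection of the kernels of [J x] and [J y], which
    contains [w]; by linearity so does [x + y]. *)
Lemma left_additive_of_projections :
  (forall H1 H2 : set X, closed_hyperplane H1 -> closed_hyperplane H2 ->
     linear_map (metric_proj (H1 `&` H2))) -> left_additive_orthogonality.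
Proof.
move=> lin x y w xw yw.
have [->|x0] := eqVneq x 0; first by rewrite add0r.
have [->|y0] := eqVneq y 0; first by rewrite addr0.
have h1 := duality_map_hyperplane _ x0; have h2 := duality_map_hyperplane _ y0.
have := lin _ _ h1 h2; set M := _ `&` _ => linP.
have hM : closed_subspace M.
  by apply: closed_subspaceI; exact: closed_hyperplane_subspace.
have M0 : M 0 by case: hM.
have projP := fun v p => metric_proj_subspaceP _ _ uc smooth M v p hM.
have Px : metric_proj M x = 0.
  by apply: (projP _ _).2; split=> // m [mx _]; rewrite subr0.
have Py : metric_proj M y = 0.
  by apply: (projP _ _).2; split=> // m [_ my]; rewrite subr0.
have := linP 1 1 x y; rewrite !scale1r Px Py addr0 => Pxy.
by have [_ /(_ w)] := (projP _ _).1 Pxy; rewrite subr0; apply.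
Qed.

(** The preimage of the span of [J x] and [J y] is a subspace, so [J (x + y)] is a combination of
    [J x] and [J y]. *)
Lemma left_additive_of_planes :
  (forall D : set (X -> R), two_dim_dual_subspace D ->
     two_dim_subspace (Jinv_image D)) -> left_additive_orthogonality.
Proof.
move=> pl x y w xw yw.
have [ind|] := pselect (forall a b,
    (fun z => a * J x z + b * J y z) = (fun=> 0) -> a = 0 /\ b = 0).
  pose D := [set h | exists a b, h = (fun z => a * J x z + b * J y z)].
  have hD : two_dim_dual_subspace D.
    by exists (J x), (J y); split=> //; exact: duality_map_dual.
  have [p [q [_ E]]] := pl _ hD.
  have Dx : Jinv_image D x by exists 1, 0; apply/funext => z; rewrite mul1r mul0r addr0.
  have Dy : Jinv_image D y by exists 0, 1; apply/funext => z; rewrite mul1r mul0r add0r.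
  have : Jinv_image D (x + y).
    move: Dx Dy; rewrite E /= => -[a [b ->]] [c [d ->]].
    by exists (a + c), (b + d); rewrite addrACA -!scalerDl.
  by move=> [a [b ->]]; rewrite xw yw !mulr0 addr0.
(* In the dependent case injectivity of [J] makes [x] and [y] proportional, and homogeneity
   finishes. *)
move=> /existsNP [a /existsNP [b /not_implyP [ab nab]]].
have axby : a *: x = (- b) *: y.
  apply: duality_map_inj => z; have := congr1 (@^~ z) ab.
  by rewrite /= !duality_map_scale//; lra.
have [a0|a0] := eqVneq a 0; last first.
  have -> : x = (- b / a) *: y by rewrite mulrC -scalerA -axby scalerA mulVf// scale1r.
  by rewrite -[y in _ + y]scale1r -scalerDl duality_map_scale// yw mulr0.
have b0 : b != 0 by apply/eqP => b0; exact: nab.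
have -> : y = 0.
  apply/eqP; move: axby; rewrite a0 scale0r => /esym/eqP.
  by rewrite scaler_eq0 oppr_eq0 (negPf b0).
by rewrite addr0.
Qed.

(** [x] and [y] lie in the polar of the cone where [J x] and [J y] are nonpositive, hence so does
    their midpoint. The cone contains [w] and [- w], which turns the inequality into an equality. *)
Lemma left_additive_of_polars :
  (forall S1 S2 : set X, closed_halfspace S1 -> closed_halfspace S2 ->
     convex_set (polar (S1 `&` S2))) -> left_additive_orthogonality.
Proof.
move=> conv x y w xw yw.
have [->|x0] := eqVneq x 0; first by rewrite add0r.
have [->|y0] := eqVneq y 0; first by rewrite addr0.
have h1 := duality_map_halfspace _ x0; have h2 := duality_map_halfspace _ y0.
have := conv _ _ h1 h2; set K := _ `&` _ => convK.
have hK : nonempty_closed_convex_cone K.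
  by apply: coneI; exact: closed_halfspace_cone.
have polP := fun v => polar_coneP _ _ uc smooth K v hK.
have Px : x \in polar K by rewrite inE; apply: (polP _).2 => k [].
have Py : y \in polar K by rewrite inE; apply: (polP _).2 => k [].
have half0 : 0 <= 2^-1 :> R by rewrite invr_ge0.
have half1 : 2^-1 <= 1 :> R by lra.
pose half := Itv01 half0 half1.
have /set_mem := convK _ _ half Px Py.
have -> : convex.conv half (x : convex_lmodType X) y = 2^-1 *: (x + y).
  rewrite scalerDr; congr (_ + _ *: _); rewrite /= /unstable.onem; lra.
move=> /polP H; have hw := H w; have hNw := H (- w).
move: hw hNw; rewrite duality_mapN// !duality_map_scale// => hw hNw.
have := hw (conj _ _); rewrite /= xw yw lexx => /(_ isT isT).
have := hNw (conj _ _); rewrite /= !duality_mapN// xw yw oppr0 lexx => /(_ isT isT).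
lra.
Qed.

Lemma inner_product_of_symmetric :
  (forall x y, J x y = J y x) -> inner_product_space X.
Proof.
move=> sym; exists J; split=> //.
- by move=> a b x y z; rewrite sym duality_mapD// !duality_mapZ// !(sym z).
- by move=> x; rewrite duality_mapxx// sqrtr_sqr ger0_norm.
Qed.

(** Cauchy-Schwarz shows that [B x / |x|] supports the norm at [x]; uniqueness of the supporting
    functional gives [J = B]. *)
Lemma duality_map_additive : inner_product_space X ->
  forall a b x y z, J (a *: x + b *: y) z = a * J x z + b * J y z.
Proof.
move=> [B [BL Bsym Bn]].
have BD x y z : B (x + y) z = B x z + B y z.
  by have := BL 1 1 x y z; rewrite !scale1r !mul1r.
have B0 z : B 0 z = 0 by have := BD 0 0 z; rewrite addr0; lra.
have BZ c x z : B (c *: x) z = c * B x z.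
  by have := BL c 0 x 0 z; rewrite scaler0 addr0 mul0r addr0.
(* [Num.sqrt] is [0] at negative numbers, so a negative [B x x] would give [|x| = 0], hence [x = 0]
   and [B x x = 0]. *)
have Bxx x : B x x = `|x| ^+ 2.
  rewrite Bn; case: (leP 0 (B x x)) => [h|h]; first by rewrite sqr_sqrtr.
  have x0 : x = 0 by apply/eqP; rewrite -normr_eq0 Bn; apply/eqP/ler0_sqrtr/ltW.
  by move: h; rewrite x0 B0 ltxx.
have Dr x y z : B x (y + z) = B x y + B x z by rewrite !(Bsym x) BD.
have Zr c x y : B x (c *: y) = c * B x y by rewrite !(Bsym x) BZ.
have CS x y : `|B x y| <= `|x| * `|y|.
  have [->|y0] := eqVneq y 0; first by rewrite Bsym B0 !normr0 mulr0.
  have n0 : 0 < `|y| by rewrite normr_gt0.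
  rewrite -ler_sqr ?nnegrE ?mulr_ge0// real_normK ?num_real// exprMn.
  have := Bxx ((`|y| ^+ 2) *: x + (- B x y) *: y).
  rewrite !BD !Dr !BZ !Zr (Bsym y x) !Bxx => E.
  have : 0 <= `|y| ^+ 2 * (`|x| ^+ 2 * `|y| ^+ 2 - B x y ^+ 2).
    by have := sqr_ge0 `| `|y| ^+ 2 *: x + - B x y *: y|; rewrite -E; lra.
  by rewrite pmulr_rge0 ?exprn_gt0// subr_ge0.
have JB x y : J x y = B x y.
  have [->|x0] := eqVneq x 0; first by rewrite duality_map0// B0.
  have n0 : 0 < `|x| by rewrite normr_gt0.
  rewrite duality_mapE// -(@norm_deriv_uniq _ _ smooth x (fun y => `|x|^-1 * B x y))//.
  - by rewrite mulrA divff ?gt_eqF// mul1r.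
  - by move=> u v; rewrite Dr mulrDr.
  - by move=> c u; rewrite Zr mulrCA.
  - by move=> u; rewrite normrM normfV normr_id mulrC ler_pdivrMr// mulrC.
  - by rewrite Bxx expr2 mulrA mulVf ?gt_eqF// mul1r.
by move=> a b x y z; rewrite !JB BL.
Qed.

(** * Consequences of linearity of the duality map *)

Section InnerProduct.
Hypothesis JL : forall a b x y z, J (a *: x + b *: y) z = a * J x z + b * J y z.

Lemma linear_metric_proj (M : set X) : closed_subspace M -> linear_map (metric_proj M).
Proof.
move=> hM a b x y.
have projP := fun v p => metric_proj_subspaceP _ _ uc smooth M v p hM.
have [Mx Hx] := (projP x _).1 erefl; have [My Hy] := (projP y _).1 erefl.
apply: (projP _ _).2; split=> [|m Mm]; first by case: hM => _ _; apply.
have -> : a *: x + b *: y - (a *: metric_proj M x + b *: metric_proj M y) =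
    a *: (x - metric_proj M x) + b *: (y - metric_proj M y).
  by rewrite !scalerBr opprD addrACA.
by rewrite JL Hx// Hy// !mulr0 addr0.
Qed.

Lemma Jinv_image_plane (D : set (X -> R)) :
  two_dim_dual_subspace D -> two_dim_subspace (Jinv_image D).
Proof.
move=> [f [g [fd gd ind ->]]].
have [x Jx] := duality_map_surj _ _ uc smooth f fd.
have [y Jy] := duality_map_surj _ _ uc smooth g gd.
have E a b : J (a *: x + b *: y) = (fun z => a * f z + b * g z).
  by apply/funext => z; rewrite JL Jx Jy.
exists x, y; split.
  move=> a b ab; apply: ind; rewrite -E ab.
  by apply/funext => z; rewrite duality_map0.
apply/seteqP; split=> z /= [a [b h]]; exists a, b; last by rewrite /= h E.
by apply: duality_map_inj => w; rewrite h E.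
Qed.

Lemma convex_polar (K : set X) : nonempty_closed_convex_cone K -> convex_set (polar K).
Proof.
move=> hK x y l; rewrite !inE => Px Py.
have polP := fun v => polar_coneP _ _ uc smooth K v hK.
apply: (polP _).2 => k Kk.
rewrite JL; have := (polP x).1 Px _ Kk; have := (polP y).1 Py _ Kk => h1 h2.
have l1 : 0 <= unstable.onem l%:num by rewrite subr_ge0.
by rewrite -oppr_ge0 opprD -!mulrN addr_ge0// mulr_ge0// oppr_ge0.
Qed.

End InnerProduct.

End Equivalences.

Theorem theorem1 (R : realType) (X : completeNormedModType R) :
  uniformly_convex X -> uniformly_smooth X -> reflexive_space X -> dim_ge3 X ->
  [<->
    (* (i) *) forall M : set X, closed_subspace M -> linear_map (metric_proj M);
    (* (ii) *) forall H1 H2 : set X, closed_hyperplane H1 -> closed_hyperplane H2 ->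
                 linear_map (metric_proj (H1 `&` H2));
    (* (iii) *) forall D : set (X -> R), two_dim_dual_subspace D ->
                 two_dim_subspace (Jinv_image D);
    (* (iv) *) forall S1 S2 : set X, closed_halfspace S1 -> closed_halfspace S2 ->
                 convex_set (polar (S1 `&` S2));
    (* (v) *) forall K : set X, nonempty_closed_convex_cone K -> convex_set (polar K);
    (* (vi) *) inner_product_space X].
Proof.
move=> uc smooth _ dim3.
(* The hub of the cycle: (ii), (iii) and (iv) each yield left additivity, and the next assertion
   then follows from linearity of [J]. *)
have linJ : left_additive_orthogonality _ X -> forall a b (x y z : X),
    duality_map (a *: x + b *: y) z = a * duality_map x z + b * duality_map y z.
  move=> la; apply: duality_map_additive => //.
  apply: inner_product_of_symmetric => //.
  exact: duality_map_sym.
tfae.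
- move=> lin H1 H2 h1 h2; apply: lin.
  by apply: closed_subspaceI; exact: closed_hyperplane_subspace.
- move=> lin; apply: Jinv_image_plane => //; apply: linJ.
  exact: left_additive_of_projections.
- move=> planes S1 S2 h1 h2; apply: convex_polar => //.
    by apply: linJ; exact: left_additive_of_planes.
  by apply: coneI; exact: closed_halfspace_cone.
- move=> conv; apply: convex_polar => //; apply: linJ.
  exact: left_additive_of_polars.
- move=> conv; apply: inner_product_of_symmetric => //.
  apply: duality_map_sym => //; apply: left_additive_of_polars => // S1 S2 h1 h2.
  by apply: conv; apply: coneI; exact: closed_halfspace_cone.
- move=> ips; apply: linear_metric_proj => //; exact: duality_map_additive.
Qed.
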